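(* Let $d \ge 1$, let $K$ be a non-archimedean local field with valuation ring $\mathcal{O}_K$, and let $\mathcal{X} = \{x_1, \dots, x_N\}$ be a (finite) dataset of points in $K^d$ of full rank, i.e. spanning $K^d$ over $K$. Then there is a unique full-dimensional (non-degenerate) Gaussian $G$ on $K^d$ that maximizes the likelihood $\mathbb{P}(\mathcal{X} \mid G)$ among all full-dimensional Gaussians on $K^d$, and its corresponding lattice is $L_{\mathcal{X}} = \mathrm{span}_{\mathcal{O}_K}(\mathcal{X})$.
   Context: A (non-archimedean) local field $K$ is a locally compact, non-discrete, totally disconnected topological field. It carries a surjective discrete valuation $\mathrm{val}: K \to \mathbb{Z} \cup \{+\infty\}$, and $\mathcal{O}_K = \{x \in K : \mathrm{val}(x) \ge 0\}$. Let $\lambda$ be the Haar measure on $K$ with $\lambda(\mathcal{O}_K) = 1$; the product measure on $K^d$ is also denoted $\lambda$. A lattice in $K^d$ is a compact $\mathcal{O}_K$-submodule of $K^d$ (these are automatically finitely generated). The Gaussian measures on $K^d$ are exactly the normalized Haar measures (uniform probability measures) on lattices in $K^d$; each Gaussian is determined by its lattice. A Gaussian is full-dimensional (non-degenerate) if its lattice $L$ has full rank $d$, in which case it has density $f_L = \frac{1}{\lambda(L)} 1_L$ with respect to $\lambda$. For the full-dimensional Gaussian $G$ with lattice $L$, the likelihood is $\mathbb{P}(\mathcal{X} \mid G) = \prod_{i=1}^N f_L(x_i)$. *)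

(* Defs.v *)
From HB Require Import structures.
From mathcomp Require Import all_boot all_order all_algebra.
From mathcomp Require Import all_classical all_reals all_analysis.

Set Implicit Arguments.
Unset Strict Implicit.
Unset Printing Implicit Defensive.

Import Order.TTheory GRing.Theory Num.Theory.

Local Open Scope classical_set_scope.
Local Open Scope ring_scope.

HB.structure Definition PreTopologicalField :=
  {K of TopologicalZmodule K & GRing.Field K}.

HB.mixin Record PreTopologicalField_isTopologicalField K
    & PreTopologicalField K := {
  field_mul_continuous : continuous (fun x : K * K => x.1 * x.2);
  field_inv_continuous :
    forall x : K, x != 0 -> {for x, continuous (GRing.inv : K -> K)}
}.

#[short(type="topologicalFieldType")]
HB.structure Definition TopologicalField :=
  {K of PreTopologicalField K & PreTopologicalField_isTopologicalField K}.

HB.mixin Record TopologicalField_isLocalField K & TopologicalField K := {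
  local_field_locally_compact : locally_compact [set: K];
  local_field_not_discrete : ~ (forall A : set K, open A);
  local_field_totally_disconnected : totally_disconnected [set: K]
}.

#[short(type="localFieldType")]
HB.structure Definition LocalField :=
  {K of TopologicalField K & TopologicalField_isLocalField K}.

(* The last clause says that the topology of [K] is the one induced by [v]. *)
Record normalized_valuation (K : localFieldType) (v : K -> \bar int) : Prop := {
  valuation_eqy : forall x, v x = +oo%E <-> x = 0;
  valuation_neqNy : forall x, v x <> -oo%E;
  valuationM : forall x y, v (x * y) = (v x + v y)%E;
  valuationD : forall x y, (Order.min (v x) (v y) <= v (x + y)%R)%E;
  valuation_surj : forall n : int, exists x, v x = n%:E;
  valuation_nbhs : forall (x : K) (A : set K),
    nbhs x A <-> exists n : int, [set y | (n%:E <= v (y - x)%R)%E] `<=` A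
}.

Definition valuation_ring (K : localFieldType) (v : K -> \bar int) : set K :=
  [set x | (0 <= v x)%E].

HB.instance Definition _ (V : PreTopologicalZmodule.type) m n :=
  Topological.on 'M[V]_(m, n).

(* [g_sigma_algebraType] needs a pointed type, and [Pointed] cannot be joined
   with [GRing.Zmodule] below [PseudoMetricNormedZmod]; hence this alias. *)
Definition borelType (V : PreTopologicalZmodule.type) : Type := V.

Section BorelType.
Variable V : PreTopologicalZmodule.type.

HB.instance Definition _ := Choice.on (borelType V).
HB.instance Definition _ := isPointed.Build (borelType V) (0 : V).

HB.instance Definition _ := @isMeasurable.Build (sigma_display (@open V))
  (borelType V) <<s @open V >> (@sigma_algebra0 _ setT (@open V))
  (@sigma_algebraC (borelType V) (@open V))
  (@sigma_algebra_bigcup _ setT (@open V)).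

End BorelType.

(* Regularity need not be required: [K] is locally compact and second
   countable, so a Borel measure that is finite on compact sets is Radon. *)
Record normalized_haar (R : realType) (K : localFieldType) (v : K -> \bar int)
    (lambda : {measure set (borelType K) -> \bar R}) : Prop := {
  haar_invariant : forall (a : K) (A : set (borelType K)), measurable A ->
    lambda [set a + x | x in A] = lambda A;
  haar_valuation_ring : lambda (valuation_ring v) = 1%E
}.

(* The rectangle formula determines the measure, [lambda] being
   sigma-finite. *)
Definition product_measure_of (R : realType) (K : localFieldType) (d : nat)
    (lambda : {measure set (borelType K) -> \bar R})
    (lambda_d : {measure set (borelType 'rV[K]_d) -> \bar R}) : Prop :=
  forall A : 'I_d -> set (borelType K), (forall i, measurable (A i)) ->
    lambda_d [set x : 'rV[K]_d | forall i, A i (x 0 i)] =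
    (\prod_(i < d) lambda (A i))%E.

Section Lattices.
Variables (K : localFieldType) (v : K -> \bar int) (d : nat).

Record is_lattice (L : set 'rV[K]_d) : Prop := {
  lattice_compact : compact L;
  lattice0 : L 0;
  latticeD : forall x y, L x -> L y -> L (x + y);
  latticeZ : forall a x, valuation_ring v a -> L x -> L (a *: x)
}.

(* A torsion-free [O_K]-module has rank at least [d] when it contains [d]
   linearly independent elements; inside [K^d] the rank is at most [d]. *)
Definition full_rank (L : set 'rV[K]_d) : Prop :=
  exists b : d.-tuple 'rV[K]_d, free b /\ forall i, L (tnth b i).

Definition span_valuation_ring (N : nat) (X : N.-tuple 'rV[K]_d) :
    set 'rV[K]_d :=
  [set y | exists c : 'I_N -> K, (forall i, valuation_ring v (c i)) /\
     y = \sum_(i < N) c i *: tnth X i].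

End Lattices.

Section Gaussians.
Variables (R : realType) (K : localFieldType) (v : K -> \bar int) (d : nat).

Definition normalized_haar_on (L : set 'rV[K]_d)
    (P : probability (borelType 'rV[K]_d) R) : Prop :=
  P L = 1%E /\
  forall (a : 'rV[K]_d) (A : set (borelType 'rV[K]_d)), L a -> measurable A ->
    P [set a + x | x in A] = P A.

Record gaussian := Gaussian {
  gaussian_lattice : set 'rV[K]_d;
  gaussian_law : probability (borelType 'rV[K]_d) R;
  gaussian_latticeP : is_lattice v gaussian_lattice;
  gaussian_lawP : normalized_haar_on gaussian_lattice gaussian_law
}.

Definition full_dimensional (G : gaussian) : Prop :=
  full_rank (gaussian_lattice G).

(* A measure is a function on all sets, so laws are only compared on
   measurable ones. *)
Definition gaussian_eq (G G' : gaussian) : Prop :=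
  gaussian_lattice G = gaussian_lattice G' /\
  forall A, measurable A -> gaussian_law G A = gaussian_law G' A.

Variable lambda_d : {measure set (borelType 'rV[K]_d) -> \bar R}.

Definition gaussian_density (L : set 'rV[K]_d) (x : 'rV[K]_d) : R :=
  (fine (lambda_d L))^-1 * \1_L x.

Definition likelihood (N : nat) (X : N.-tuple 'rV[K]_d) (G : gaussian) : R :=
  \prod_(i < N) gaussian_density (gaussian_lattice G) (tnth X i).

Definition maximizes_likelihood (N : nat) (X : N.-tuple 'rV[K]_d)
    (G : gaussian) : Prop :=
  full_dimensional G /\
  forall G', full_dimensional G' -> likelihood X G' <= likelihood X G.

End Gaussians.

(* Main.v *)
(* A full-rank dataset spans a compact open subgroup [L] of [K^d]; a lattice has
   nonzero likelihood iff it contains the data, hence [L], and then its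
   likelihood is [lambda M ^ -N].  So [L] is optimal, and any other optimal [M]
   would contain a coset of [L] disjoint from [L], giving
   [lambda M >= 2 lambda L].
   The measure theory rests on the cosets of the balls: together with the empty
   set they form a countably generated pi-system generating the Borel sets, so
   a measure is determined by its values on them, and a translation-invariant
   measure of a compact subgroup is a finite multiple, depending only on the
   index, of the measure of a ball inside it. *)

Require Import Defs.
From HB Require Import structures.
From mathcomp Require Import finmap all_boot all_order all_algebra.
From mathcomp Require Import all_classical all_reals all_analysis.

Set Implicit Arguments.
Unset Strict Implicit.
Unset Printing Implicit Defensive.

Import Order.TTheory GRing.Theory Num.Theory.

Local Open Scope classical_set_scope.
Local Open Scope ring_scope.

(** * Compact open subgroups and their cosets *)

(** The equivalence of the two notions of compactness is stated for pointed spaces, so [V] is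
    repacked with [0] as its point; the topology does not change. *)
Lemma compact_finite_cover (V : PreTopologicalZmodule.type) (A : set V) :
  compact A -> cover_compact A.
Proof.
pose T : ptopologicalType := HB.pack V (isPointed.Build V (0 : V)).
suff: forall A : set T, compact A -> cover_compact A by exact.
by rewrite compact_cover.
Qed.

Lemma compact_rV (V : PreTopologicalZmodule.type) n (A : 'I_n -> set V) :
  (forall i, compact (A i)) ->
  compact [set x : 'rV[V]_n | forall i, A i (x 0 i)].
Proof.
pose T : ptopologicalType := HB.pack V (isPointed.Build V (0 : V)).
exact: (@rV_compact T n).
Qed.

Section SubgroupBasis.
Variable V : PreTopologicalZmodule.type.

Record is_subgroup (H : set V) : Prop := {
  subgroup0 : H 0;
  subgroupB : forall x y, H x -> H y -> H (x - y)
}.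

(** Abstracts what the balls of [K] and of [K^d] share, so that the measure theory is done once for
    both. Once the [B n] are compact, [basis_cover] makes the space sigma-compact. *)
Record subgroup_basis (B : int -> set V) : Prop := {
  basis_subgroup : forall n, is_subgroup (B n);
  basis_le : forall m n, m <= n -> B n `<=` B m;
  basis_nbhs : forall (x : V) (A : set V),
    nbhs x A <-> exists n, [set y | B n (y - x)] `<=` A;
  basis_cover : forall x, exists n, B n x
}.

(** Written as the preimage of [H] under translation by [- a], so that membership unfolds by
    computation; [H] may be an arbitrary set. *)
Definition coset (H : set V) (a : V) : set V := [set x | H (x - a)].

Lemma coset_image (H : set V) a : [set a + x | x in H] = coset H a.
Proof.
apply/seteqP; split => [_ [x Hx <-]|x Hx]; first by rewrite /coset /= addrC addKr.
by exists (x - a) => //; rewrite addrC subrK.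
Qed.

Lemma coset0 (H : set V) : coset H 0 = H.
Proof. by apply/seteqP; split => x; rewrite /coset /= subr0. Qed.

Section Subgroup.
Variables (H : set V) (HH : is_subgroup H).

Lemma subgroupN x : H x -> H (- x).
Proof. by move=> Hx; rewrite -sub0r; apply: subgroupB => //; exact: subgroup0. Qed.

Lemma subgroupD x y : H x -> H y -> H (x + y).
Proof. by move=> Hx Hy; rewrite -(opprK y); apply: subgroupB => //; exact: subgroupN. Qed.

Lemma coset_refl a : coset H a a.
Proof. by rewrite /coset /= subrr; exact: subgroup0. Qed.

Lemma coset_eq a b : coset H b a -> coset H a = coset H b.
Proof.
move=> Hab; apply/seteqP; split => x; rewrite /coset /= => Hx.
  by rewrite -(subrKA a); exact: subgroupD.
by rewrite -(subrKA b) -(opprB a b); exact: subgroupB.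
Qed.

Lemma coset_meet a b x : coset H a x -> coset H b x -> coset H a = coset H b.
Proof. by move=> /coset_eq <- /coset_eq <-. Qed.

End Subgroup.

Lemma coset_sub (H L : set V) a :
  is_subgroup L -> H `<=` L -> L a -> coset H a `<=` L.
Proof.
move=> LL HL La x /HL Lxa; rewrite -(subrK a x).
exact: (subgroupD LL Lxa La).
Qed.

Variables (B : int -> set V) (HB : subgroup_basis B).

(** Any point [x] of the coset can serve as its centre, and then [x + B m] stays inside. Containing
    some [B m] is how openness of a subgroup is expressed from here on. *)
Lemma coset_open H m a : is_subgroup H -> B m `<=` H -> open (coset H a).
Proof.
move=> HH BH; rewrite openE => x Hx; apply/(basis_nbhs HB); exists m => y Byx.
by rewrite -(coset_eq HH Hx); exact: BH.
Qed.

Lemma subgroup_open H m : is_subgroup H -> B m `<=` H -> open H.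
Proof. by move=> HH BH; rewrite -(coset0 H); exact: coset_open BH. Qed.

(** If [x] is in the closure, its open coset [x + H] meets [H], which puts [x] in [H]. *)
Lemma subgroup_closed H m : is_subgroup H -> B m `<=` H -> closed H.
Proof.
move=> HH BH x /(_ (coset H x)) [].
  by apply: open_nbhs_nbhs; split; [exact: coset_open BH|exact: coset_refl].
move=> y [Hy Hyx]; rewrite -(subKr y x); exact: subgroupB.
Qed.

Lemma measurable_open (U : set V) : open U -> measurable (U : set (borelType V)).
Proof. exact: sub_sigma_algebra. Qed.

Lemma measurable_subgroup H m : is_subgroup H -> B m `<=` H ->
  measurable (H : set (borelType V)).
Proof. by move=> HH BH; apply: measurable_open; exact: (subgroup_open HH BH). Qed.

Lemma basis_open n a : open (coset (B n) a).
Proof. by apply: (@coset_open _ n) => //; exact: basis_subgroup. Qed.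

(** The representatives are taken in [L], so that invariance under translations by [L] alone will
    suffice. *)
Lemma finite_cosets H L m : is_subgroup H -> B m `<=` H -> compact L ->
  exists2 D : {fset V}, (forall a, a \in D -> L a) & L `<=` \bigcup_(a in [set` D]) coset H a.
Proof.
move=> HH BH /compact_finite_cover cL.
have [a _|x Lx|D DL LD] := cL _ L (coset H); first exact: coset_open BH.
  by exists x => //; exact: coset_refl.
by exists D => // a /DL; rewrite inE.
Qed.

(** * Countable generation of the Borel sets by cosets *)

Hypothesis Bcompact : forall n, compact (B n).

(** The space is the union of the compact sets [B (- k)], [k] natural, and finitely many cosets of
    [B n] cover each of them. *)
Lemma basis_dense :
  exists g : int -> nat -> V, forall n x, exists i, coset (B n) (g n i) x.
Proof.
have /choice [D DP] (nk : int * nat) : exists D : {fset V},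
    B (- nk.2%:Z) `<=` \bigcup_(a in [set` D]) coset (B nk.1) a.
  have [D _ BD] := finite_cosets (basis_subgroup HB nk.1) (@subset_refl _ _)
    (@Bcompact (- nk.2%:Z)).
  by exists D.
(* The index [i] encodes a pair [(k, j)]: the [j]-th centre in the cover of [B (- k)]. Indices that
   decode to nothing get the harmless value [0]. *)
exists (fun n i => if unpickle i is Some (k, j) then nth 0 (D (n, k)) j else 0).
move=> n x; have [p Bpx] := basis_cover HB x.
have /(DP (n, `|p|%N)) [a /= aD xa] : B (- `|p|%N%:Z) x.
  by apply: (basis_le HB) Bpx; rewrite abszE lerNl ler_normr lexx orbT.
exists (pickle (`|p|%N, index a (D (n, `|p|%N)))).
by rewrite pickleK nth_index.
Qed.

(** The bound [m] keeps only small balls: those whose measure is known to be finite, or those inside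
    a given lattice. The empty set is there for stability under intersection. *)
Definition cosets_from m : set (set V) :=
  [set A | A = set0 \/ exists n a, m <= n /\ A = coset (B n) a].

(** Two cosets that meet can both be centred at a common point, and then they are nested. *)
Lemma setI_closed_cosets m : setI_closed (cosets_from m).
Proof.
move=> A A' [-> _|[n [a [mn ->]]]]; first by left; rewrite set0I.
move=> [->|[n' [a' [mn' ->]]]]; first by left; rewrite setI0.
have [->|/set0P [x [xa xa']]] := eqVneq (coset (B n) a `&` coset (B n') a') set0.
  by left.
right; rewrite -(coset_eq (basis_subgroup HB n) xa).
rewrite -(coset_eq (basis_subgroup HB n') xa').
have [nn'|/ltW nn'] := leP n n'.
  exists n', x; split => //; apply/seteqP; split => [y []|y xy] //.
  by split => //; exact: (basis_le HB nn').
exists n, x; split => //; apply/seteqP; split => [y []|y xy] //.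
by split => //; exact: (basis_le HB nn').
Qed.

Lemma borel_cosets m :
  (measurable : set (set (borelType V))) = <<s cosets_from m >>.
Proof.
apply/seteqP; split; apply: smallest_sub.
- exact: smallest_sigma_algebra.
- move=> U /= oU; have [g gP] := basis_dense.
  (* An open set is the union of the countably many enumerated cosets of level at least [m] that it
     contains; the other cosets are replaced by [set0]. *)
  pose W (p : nat * nat) := if asbool (coset (B (m + p.1%:Z)) (g (m + p.1%:Z) p.2) `<=` U)
    then coset (B (m + p.1%:Z)) (g (m + p.1%:Z) p.2) else set0.
  have -> : U = \bigcup_i (if unpickle i is Some p then W p else set0).
    apply/seteqP; split=> [x Ux|x [i _]]; last first.
      by case: unpickle => // p; rewrite /W; case: asboolP => [WU /WU|_ []].
    have [n BU] : exists n, coset (B n) x `<=` U.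
      by apply/(basis_nbhs HB); apply: open_nbhs_nbhs.
    have [k nk] : exists k : nat, n <= m + k%:Z.
      by exists `|n - m|%N; rewrite abszE -lerBlDl ler_norm.
    have [i xi] := gP (m + k%:Z) x.
    exists (pickle (k, i)) => //; rewrite pickleK /W /=; case: asboolP => // -[].
    rewrite -(coset_eq (basis_subgroup HB _) xi) => y xy.
    by apply: BU; exact: (basis_le HB nk).
  apply: sigma_algebra_bigcup => i.
  case: unpickle => [p|]; last by apply: sub_sigma_algebra; left.
  rewrite /W; case: asboolP => _; last by apply: sub_sigma_algebra; left.
  apply: sub_sigma_algebra; right; exists (m + p.1%:Z), (g (m + p.1%:Z) p.2).
  by split => //; rewrite lerDl.
- exact: smallest_sigma_algebra.
- move=> A [->|[n [a [_ ->]]]]; first exact: sigma_algebra0.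
  by apply: measurable_open; exact: basis_open.
Qed.

(** * Measures determined by their values on cosets *)

Section Measure.
Variable R : realType.
Implicit Types mu nu : {measure set (borelType V) -> \bar R}.

(* [k] is the index of [H] in [L]: it does not depend on the measure. *)
Lemma coset_count H L m : is_subgroup H -> is_subgroup L -> B m `<=` H ->
    H `<=` L -> compact L ->
  exists k : nat, forall mu,
    (forall a, L a -> mu (coset H a) = mu H) -> mu L = (k%:R%:E * mu H)%E.
Proof.
move=> HH LL BH HL cL; have [D DL LD] := finite_cosets HH BH cL.
(* Distinct elements of [D] may represent the same coset, so the cosets themselves are counted. *)
pose C := [set coset H a | a in [set` D]].
have finC : finite_set C by apply: finite_image; exact: finite_fset.
have CL E : C E -> exists2 a, L a & E = coset H a.
  by move=> [a /= aD <-]; exists a => //; exact: DL.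
exists #|` fset_set C| => mu muH.
have -> : L = \bigcup_(E in C) E.
  apply/seteqP; split => [x /LD [a Da Hx]|x [E /CL [a La ->]]].
    by exists (coset H a) => //; exists a.
  exact: coset_sub.
rewrite (@measure_fin_bigcup _ _ _ mu _ C id) //; last 2 first.
- move=> E F /CL [a _ ->] /CL [b _ ->] [x [xa xb]].
  by exact: (coset_meet HH xa xb).
- by move=> E /CL [a _ ->]; apply: measurable_open; exact: coset_open BH.
rewrite fsbig_finite //=.
rewrite (eq_big_seq (fun _ => mu H)).
  by rewrite big_const_seq count_predT iter_addr_0 mule_natl.
by move=> E; rewrite in_fset_set// inE => /CL [a La ->]; exact: muH.
Qed.

Lemma measure_eq_cosets m mu nu :
    (forall n a, m <= n -> mu (coset (B n) a) = nu (coset (B n) a)) ->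
    (forall a, (mu (coset (B m) a) < +oo)%E) ->
  forall A : set (borelType V), measurable A -> mu A = nu A.
Proof.
move=> munu mufin; have [g gP] := basis_dense.
apply: (@measure_unique _ R (borelType V) (cosets_from m) (fun i => coset (B m) (g m i))) => //.
- exact: borel_cosets.
- exact: setI_closed_cosets.
- by move=> i; right; exists m, (g m i).
- by apply/seteqP; split => // x _; have [i xi] := gP m x; exists i.
- by move=> A [->|[n [a [mn ->]]]]; [rewrite !measure0|exact: munu].
Qed.

Lemma open_translate a (U : set V) : open U -> open [set x | U (x - a)].
Proof.
rewrite !openE => oU x /= /oU /(basis_nbhs HB) [n BU].
apply/(basis_nbhs HB); exists n => y Byx; apply: BU => /=.
by rewrite opprB addrA subrK.
Qed.

Lemma measurable_translate (a : V) :
  measurable_fun setT ((fun x => x - a) : borelType V -> borelType V).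
Proof.
apply: (@measurability _ _ _ (borelType V) _ _ (@open V)) => // _ [U oU <-].
by rewrite setTI; apply: measurable_open; exact: open_translate.
Qed.

Lemma measurable_translate_image a (A : set (borelType V)) :
  measurable A -> measurable ([set a + x | x in A] : set (borelType V)).
Proof.
move=> mA; rewrite coset_image -[coset A a]setTI.
exact: measurable_translate.
Qed.

(** [A] is sent to the measure of [a + A] by the pushforward of [mu] under [x - a]. This measure
    agrees with [mu] on small cosets, hence everywhere. *)
Lemma translation_invariant m mu :
    (forall n a, m <= n -> mu (coset (B n) a) = mu (B n)) -> (mu (B m) < +oo)%E ->
  forall a (A : set (borelType V)), measurable A -> mu [set a + x | x in A] = mu A.
Proof.
move=> mucoset mufin a A mA.
pose pushm : {measure set (borelType V) -> \bar R} :=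
  pushforward mu ((fun x => x - a) : borelType V -> borelType V).
pose nu := pushm (measurable_translate a).
rewrite coset_image; symmetry; change (mu A = nu A).
apply: (@measure_eq_cosets m mu nu) => // [n b mn|b]; last by rewrite mucoset.
rewrite mucoset// /nu /pushm /= /pushforward.
rewrite (_ : _ @^-1` _ = coset (B n) (b + a)) ?mucoset//.
by apply/seteqP; split => x; rewrite /coset /= [b + a]addrC opprD addrA.
Qed.

(** [L] contains [B m], and is a union of finitely many of its cosets. *)
Lemma compact_subgroup_measure m mu L :
    is_subgroup L -> compact L -> B m `<=` L ->
    (forall n a, m <= n -> mu (coset (B n) a) = mu (B n)) ->
    (0 < mu (B m) < +oo)%E -> (0 < mu L < +oo)%E.
Proof.
move=> LL cL BL mucoset /andP[mu0 muoo].
have mB := measurable_subgroup (basis_subgroup HB m) (@subset_refl _ (B m)).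
have mL := measurable_subgroup LL BL.
apply/andP; split; first by apply: (lt_le_trans mu0); apply: le_measure => //; rewrite inE.
have [k ->] := coset_count (basis_subgroup HB m) LL (@subset_refl _ _) BL cL; last first.
  by move=> a _; exact: mucoset.
exact: lte_mul_pinfty.
Qed.

(** For [n] at least [m], a coset of [B n] lies either inside [L], where its mass is forced by the
    index, or in the complement of [L], which is null. *)
Lemma haar_probability_unique m L (P P' : probability (borelType V) R) :
    is_subgroup L -> compact L -> B m `<=` L -> P L = 1%E -> P' L = 1%E ->
    (forall a (A : set (borelType V)), L a -> measurable A ->
      P [set a + x | x in A] = P A) ->
    (forall a (A : set (borelType V)), L a -> measurable A ->
      P' [set a + x | x in A] = P' A) ->
  forall A : set (borelType V), measurable A -> P A = P' A.
Proof.
move=> LL cL BL PL P'L Pinv P'inv.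
have mL := measurable_subgroup LL BL.
apply: (@measure_eq_cosets m P P') => [n a mn|a]; last first.
  apply: le_lt_trans (ltry 1); apply: probability_le1.
  by apply: measurable_open; exact: basis_open.
have BnL : B n `<=` L by apply: subset_trans BL; exact: (basis_le HB mn).
have HBn := basis_subgroup HB n.
have oBn b := basis_open n b.
have [La|nLa] := pselect (L a).
  have mBn := measurable_subgroup HBn (@subset_refl _ (B n)).
  have [k kP] := coset_count HBn LL (@subset_refl _ _) BnL cL.
  (* Invariance forces mass [1 / k] on each of the [k] cosets filling [L]. *)
    have PB (Q : probability (borelType V) R) : Q L = 1%E ->
      (forall b (A : set (borelType V)), L b -> measurable A ->
        Q [set b + x | x in A] = Q A) ->
      Q (coset (B n) a) = (k%:R^-1)%:E.
    move=> QL Qinv; rewrite -coset_image Qinv//.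
    have /(kP Q) : forall b, L b -> Q (coset (B n) b) = Q (B n).
      by move=> b Lb; rewrite -coset_image Qinv.
    move=> QLk; have {QLk} : 1%E = (k%:R%:E * Q (B n))%E by rewrite -{1}QL.
    by rewrite -(fineK (fin_num_measure Q _ mBn)) -EFinM => -[] /esym/mulr1_eq ->.
  by transitivity (k%:R^-1 : R)%:E; [|symmetry]; exact: PB.
have sub : coset (B n) a `<=` ~` L.
  move=> x xa Lx; apply: nLa; rewrite -(subKr x a).
  by apply: subgroupB => //; exact: BnL.
have P0 (Q : probability (borelType V) R) : Q L = 1%E -> Q (coset (B n) a) = 0%E.
  move=> QL; apply: (@subset_measure0 _ _ _ Q _ (~` L)) => //.
  - by apply: measurable_open.
  - exact: measurableC.
  - by have := probability_setC Q mL; rewrite QL subee.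
by transitivity (0 : \bar R)%E; [|symmetry]; exact: P0.
Qed.

Lemma haar_probability_exists m mu L :
    is_subgroup L -> B m `<=` L -> (0 < mu L < +oo)%E ->
    (forall a (A : set (borelType V)), measurable A ->
      mu [set a + x | x in A] = mu A) ->
  exists P : probability (borelType V) R, P L = 1%E /\
    forall a (A : set (borelType V)), L a -> measurable A ->
      P [set a + x | x in A] = P A.
Proof.
move=> LL BL /andP[mu0 muoo] muinv.
have mL := measurable_subgroup LL BL.
(* The Dirac mass is only the default value required by [mnormalize]. *)
pose P : probability (borelType V) R :=
  mnormalize (mrestr mu mL) (@dirac _ (borelType V) 0 R).
have PE A : P A = (mu (A `&` L) * ((fine (mu L))^-1)%:E)%E.
  by rewrite /P /= /mnormalize /= /mrestr setTI gt_eqF// lt_eqF.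
have fL : 0 < fine (mu L) by rewrite fine_gt0// mu0.
exists P; split.
  apply: etrans (PE L) _; rewrite setIid -[X in (X * _)%E]fineK.
    by rewrite -EFinM divff// gt_eqF.
  by rewrite ge0_fin_numE.
move=> a A La mA; apply: etrans (PE _) _; apply: etrans _ (esym (PE _)).
congr (_ * _)%E.
(* As [a] is in [L], translating [A] and then cutting by [L] is the same as translating the
   intersection of [A] and [L]. *)
rewrite -(muinv a (A `&` L)); last exact: measurableI.
congr (mu _); apply/seteqP; split => [_ [[x Ax <-] Lx]|_ [x [Ax Lx] <-]].
  by exists x => //; split => //; rewrite -(addKr a x) addrC; exact: subgroupB.
by split; [exists x|exact: subgroupD].
Qed.

End Measure.
End SubgroupBasis.

(** * Balls of the valuation *)

Section Valuation.
Variables (K : localFieldType) (v : K -> \bar int) (Hv : normalized_valuation v).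

(** The [n]-th power of the maximal ideal, as a fractional ideal. [vball 0] is convertible to
    [valuation_ring v], which later proofs exploit. *)
Definition vball (n : int) : set K := [set x | (n%:E <= v x)%E].

Lemma valuation_fin x : x != 0 -> exists n, v x = n%:E.
Proof.
case E: (v x) => [n| |] x0; first by exists n.
  by move/(valuation_eqy Hv): E x0 => ->; rewrite eqxx.
by have := valuation_neqNy Hv E.
Qed.

Lemma valuation1 : v 1 = 0%E.
Proof.
have [n n1] := valuation_fin (oner_neq0 K).
have := valuationM Hv 1 1; rewrite mulr1 n1 -EFinD => -[] /eqP.
by rewrite -subr_eq0 opprD addNKr oppr_eq0 => /eqP ->.
Qed.

Lemma valuationN1 : v (-1) = 0%E.
Proof.
have [|n n1] := @valuation_fin (-1); first by rewrite oppr_eq0 oner_neq0.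
have := valuationM Hv (-1) (-1); rewrite mulrNN mulr1 valuation1 n1 -EFinD => -[] /eqP.
by rewrite -mulr2n eq_sym mulrn_eq0 => /eqP ->.
Qed.

Lemma vball0 n : vball n 0.
Proof. by rewrite /vball /= (_ : v 0 = +oo%E) ?leey//; exact/(valuation_eqy Hv). Qed.

Lemma vballD n x y : vball n x -> vball n y -> vball n (x + y).
Proof.
by move=> nx ny; apply: le_trans (valuationD Hv x y); rewrite le_min; apply/andP.
Qed.

Lemma vballM m n x y : vball m x -> vball n y -> vball (m + n) (x * y).
Proof. by move=> mx ny; rewrite /vball /= (valuationM Hv) EFinD; exact: leeD. Qed.

Lemma vball_sum n (I : finType) (f : I -> K) :
  (forall i, vball n (f i)) -> vball n (\sum_i f i).
Proof.
move=> nf; elim/big_ind : _ => //; [exact: vball0|exact: vballD].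
Qed.

Lemma vball_subgroup n : is_subgroup (vball n).
Proof.
split=> [|x y nx ny]; first exact: vball0.
apply: vballD => //; rewrite -mulN1r -[n]add0r; apply: vballM => //.
by rewrite /vball /= valuationN1.
Qed.

Lemma vball_le m n : m <= n -> vball n `<=` vball m.
Proof. by move=> mn x; apply: le_trans; rewrite lee_fin. Qed.

Lemma vball_cover x : exists n, vball n x.
Proof.
have [->|/valuation_fin[n n1]] := eqVneq x 0; first by exists 0; exact: vball0.
by exists n; rewrite /vball /= n1.
Qed.

Lemma vball_uniform (I : finType) (f : I -> K) : exists n, forall i, vball n (f i).
Proof.
have /choice [n nP] := fun i => vball_cover (f i).
(* A common lower bound of all [n i] that makes sense also for an empty index type. *)
exists (- \sum_i `|n i|) => i; apply: vball_le (nP i).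
rewrite lerNl; apply: (@le_trans _ _ `|n i|); first by rewrite -normrN ler_norm.
by rewrite (bigD1 i)//= lerDl sumr_ge0.
Qed.

Lemma scalar_of_valuation n : exists2 t : K, t != 0 & v t = n%:E.
Proof.
have [t tn] := valuation_surj Hv n; exists t => //.
by apply/eqP => /(valuation_eqy Hv); rewrite tn.
Qed.

Lemma valuationV x n : v x = n%:E -> v x^-1 = (- n)%:E.
Proof.
move=> xn; have x0 : x != 0 by apply/eqP => /(valuation_eqy Hv); rewrite xn.
have [|k kE] := @valuation_fin x^-1; first by rewrite invr_eq0.
have := valuationM Hv x x^-1; rewrite mulfV// valuation1 xn kE -EFinD => -[] /esym/eqP.
by rewrite addr_eq0 => /eqP ->; rewrite opprK.
Qed.

(** Surjectivity of the valuation gives a scalar of valuation [n - m]. This carries compactness from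
    one ball to all. *)
Lemma vball_scale m n : exists t : K, vball n = [set t * x | x in vball m].
Proof.
have [t t0 tn] := scalar_of_valuation (n - m); exists t.
apply/seteqP; split => [x xn|_ [x xm <-]].
  exists (t^-1 * x); last by rewrite mulVKf.
  rewrite (_ : m = - (n - m) + n); last by rewrite opprB subrK.
  by apply: vballM => //; rewrite /vball /= (valuationV tn).
rewrite -(subrK m n); apply: vballM => //.
by rewrite /vball /= tn.
Qed.

Lemma nbhs_vball (x : K) (A : set K) :
  nbhs x A <-> exists n, [set y | vball n (y - x)] `<=` A.
Proof. exact: (valuation_nbhs Hv). Qed.

Lemma vball_basis : subgroup_basis vball.
Proof.
by split; [exact: vball_subgroup|exact: vball_le|exact: nbhs_vball|exact: vball_cover].
Qed.

Lemma scale_continuous (t : K) : continuous (fun x => t * x).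
Proof.
move=> x A /nbhs_vball [n nA]; have [k kt] := vball_cover t.
apply/nbhs_vball; exists (n - k) => y /= yx; apply: nA.
by rewrite /= -mulrBr -(subrKC k n); exact: vballM.
Qed.

(** A compact neighbourhood of [0] contains some ball, which is closed and hence compact; every
    other ball is a scaling of it. *)
Lemma vball_compact n : compact (vball n).
Proof.
have /(_ (0 : K) I) [U nU [cU clU]] := @local_field_locally_compact K.
have /nbhs_vball [m mU] : nbhs (0 : K) U.
  by move: nU; rewrite withinET.
have cm : compact (vball m).
  apply: (subclosed_compact _ cU).
    exact: (subgroup_closed vball_basis (vball_subgroup m) (@subset_refl _ _)).
  by move=> x xm; apply: mU; rewrite /= subr0.
have [t ->] := vball_scale m n; apply: continuous_compact => //.
by apply: continuous_subspaceT; exact: scale_continuous.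
Qed.

End Valuation.

(** * Balls of [K^d] *)

Section RowBalls.
Variables (K : localFieldType) (v : K -> \bar int) (Hv : normalized_valuation v).
Variable d : nat.

Definition rball (n : int) : set 'rV[K]_d := [set x | forall i, vball v n (x 0 i)].

Lemma rball_subgroup n : is_subgroup (rball n).
Proof.
split=> [i|x y nx ny i]; rewrite !mxE.
  exact: vball0.
by apply: subgroupB; [exact: vball_subgroup|exact: nx|exact: ny].
Qed.

Lemma nbhs_rball (x : 'rV[K]_d) (A : set 'rV[K]_d) :
  nbhs x A <-> exists n, [set y | rball n (y - x)] `<=` A.
Proof.
split=> [[P xP PA]|[n nA]].
  have /choice [n nP] i : exists n, [set y | vball v n (y - x 0 i)] `<=` P 0 i.
    exact/(nbhs_vball Hv).
  exists (\sum_i `|n i|) => y yx; apply: PA => i j; rewrite ord1.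
  apply: nP => /=; have := yx j; rewrite !mxE; apply: vball_le.
  apply: (le_trans (ler_norm _)).
  by rewrite (bigD1 j)//= lerDl sumr_ge0.
exists (fun i j => [set y | vball v n (y - x i j)]) => [i j|y yx].
  by apply/(nbhs_vball Hv); exists n.
by apply: nA => j; rewrite !mxE; exact: yx.
Qed.

Lemma rball_basis : subgroup_basis rball.
Proof.
split.
- exact: rball_subgroup.
- by move=> m n mn x xn i; apply: (vball_le mn).
- exact: nbhs_rball.
- by move=> x; have [n xn] := vball_uniform Hv (fun i => x 0 i); exists n.
Qed.

Lemma rball_compact n : compact (rball n).
Proof. by apply: (@compact_rV K d (fun=> vball v n)) => i; exact: vball_compact. Qed.

(** Brings the coset to the rectangular form evaluated by [product_measure_of]. *)
Lemma coset_rball n a :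
  coset (rball n) a = [set x | forall i, coset (vball v n) (a 0 i) (x 0 i)].
Proof. by apply/seteqP; split => x ax i; have := ax i; rewrite /coset /= !mxE. Qed.

End RowBalls.

(** * Haar measure of lattices *)

Section Haar.
Variables (R : realType) (K : localFieldType) (v : K -> \bar int).
Hypothesis Hv : normalized_valuation v.
Variable lambda : {measure set (borelType K) -> \bar R}.
Hypothesis Hlambda : normalized_haar v lambda.

Let measurable_vball n : measurable (vball v n : set (borelType K)).
Proof. exact: (measurable_subgroup (vball_basis Hv) (vball_subgroup Hv n) (@subset_refl _ _)). Qed.

Lemma haar_coset n a : lambda (coset (vball v n) a) = lambda (vball v n).
Proof. by rewrite -coset_image (haar_invariant Hlambda). Qed.

(** The ball lies in the valuation ring, of measure one, and has finite index [k] there: [k] times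
    its measure is one, so it is not null. *)
Lemma haar_vball n : 0 <= n -> (0 < lambda (vball v n) < +oo)%E.
Proof.
move=> n0; have nO : vball v n `<=` vball v 0 by exact: vball_le.
have lO : lambda (vball v 0) = 1%E by exact: (haar_valuation_ring Hlambda).
have [k kP] := coset_count (vball_basis Hv) R (vball_subgroup Hv n)
  (vball_subgroup Hv 0) (@subset_refl _ _) nO (vball_compact Hv (n := 0)).
have := kP lambda (fun a _ => haar_coset n a); rewrite lO => k1.
apply/andP; split.
  rewrite lt0e measure_ge0 andbT; apply/eqP => l0.
  by move/eqP: k1; rewrite l0 mule0 onee_eq0.
apply: (@le_lt_trans _ _ 1%E); last exact: ltry.
by rewrite -lO; apply: le_measure; rewrite ?inE.
Qed.

Variables (d : nat) (lambda_d : {measure set (borelType 'rV[K]_d) -> \bar R}).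
Hypothesis Hlambda_d : product_measure_of lambda lambda_d.

Lemma product_haar_coset n a :
  lambda_d (coset (rball v n) a) = (\prod_(i < d) lambda (vball v n))%E.
Proof.
rewrite coset_rball.
rewrite (Hlambda_d (A := fun i => coset (vball v n) (a 0 i))) => [|i].
  by apply: eq_bigr => i _; exact: haar_coset.
by apply: measurable_open; exact: (basis_open (vball_basis Hv)).
Qed.

Lemma product_haar_coset0 n a :
  lambda_d (coset (rball v n) a) = lambda_d (rball v n).
Proof. by rewrite -[in RHS](coset0 (rball v n)) !product_haar_coset. Qed.

Lemma product_haar_rball n : 0 <= n -> (0 < lambda_d (rball v n) < +oo)%E.
Proof.
move=> n0; rewrite -(coset0 (rball v n)) product_haar_coset.
elim/big_ind : _ => [|x y /andP[x0 xoo] /andP[y0 yoo]|i _].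
- by rewrite lte01 ltry.
- by rewrite mule_gt0//= lte_mul_pinfty ?ge0_fin_numE// ltW.
- exact: haar_vball.
Qed.

Lemma product_haar_invariant (a : 'rV[K]_d) (A : set (borelType 'rV[K]_d)) :
  measurable A -> lambda_d [set a + x | x in A] = lambda_d A.
Proof.
apply: (translation_invariant (rball_basis Hv d) (rball_compact Hv (d := d)) (m := 0)).
- by move=> n b _; exact: product_haar_coset0.
- by have /andP[] := product_haar_rball (lexx 0).
Qed.

Lemma product_haar_subgroup m (L : set 'rV[K]_d) :
  is_subgroup L -> compact L -> rball v m `<=` L -> (0 < lambda_d L < +oo)%E.
Proof.
(* Ball measures are controlled for nonnegative indices only, hence the smaller ball of index
   [|m|]. *)
move=> LL cL mL; apply: (compact_subgroup_measure (rball_basis Hv d) (m := `|m|)) => //.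
- apply: subset_trans mL => x xm i; apply: vball_le (xm i); exact: ler_norm.
- by move=> n a _; exact: product_haar_coset0.
- by apply: product_haar_rball.
Qed.

Lemma product_haar_strict m (L M : set 'rV[K]_d) :
    is_subgroup L -> is_subgroup M -> compact L -> rball v m `<=` L ->
    L `<=` M -> lambda_d M = lambda_d L -> M = L.
Proof.
move=> LL MM cL mL LM eqLM; apply/seteqP; split => // y My.
apply: contrapT => nLy.
have /andP[l0 loo] := product_haar_subgroup LL cL mL.
have mesL := measurable_subgroup (rball_basis Hv d) LL mL.
have mesM := measurable_subgroup (rball_basis Hv d) MM (subset_trans mL LM).
have mesy := measurable_translate_image (rball_basis Hv d) y mesL.
have ly : lambda_d (coset L y) = lambda_d L.
  by rewrite -coset_image; exact: product_haar_invariant.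
rewrite coset_image in mesy.
have dis : L `&` coset L y = set0.
  apply/seteqP; split => x // [Lx Lxy]; apply: nLy.
  by rewrite -(subKr x y); exact: subgroupB.
have : (lambda_d (L `|` coset L y) <= lambda_d M)%E.
  apply: le_measure; rewrite ?inE//; first exact: measurableU.
  by rewrite subUset; split => //; exact: coset_sub.
have -> : lambda_d (L `|` coset L y) = (lambda_d L + lambda_d L)%E.
  by apply: etrans (measureU _ mesL mesy dis) _; congr (_ + _)%E.
(* Cancelling the finite [lambda_d L] leaves [lambda_d L <= 0], against its positivity. *)
rewrite eqLM -[X in (_ <= X)%E]adde0 leeD2lE ?ge0_fin_numE//.
by move=> /(lt_le_trans l0); rewrite ltxx.
Qed.

End Haar.

(** * The lattice spanned by the data *)

Section SpanLattice.
Variables (K : localFieldType) (v : K -> \bar int).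
Hypothesis Hv : normalized_valuation v.
Variables (d N : nat) (X : N.-tuple 'rV[K]_d).

Notation L := (span_valuation_ring v X).

Lemma lattice_subgroup (M : set 'rV[K]_d) : is_lattice v M -> is_subgroup M.
Proof.
move=> LM; split=> [|x y Mx My]; first exact: (lattice0 LM).
apply: (latticeD LM) => //; rewrite -scaleN1r; apply: (latticeZ LM) => //.
by rewrite /valuation_ring /= valuationN1.
Qed.

Lemma span_min (M : set 'rV[K]_d) :
  is_lattice v M -> (forall i, M (tnth X i)) -> L `<=` M.
Proof.
move=> LM XM _ [c [cO ->]]; elim/big_ind : _ => [|x y|i _].
- exact: (lattice0 LM).
- exact: (latticeD LM).
- exact: (latticeZ LM).
Qed.

Lemma span_gen i : L (tnth X i).
Proof.
exists (fun j => (j == i)%:R); split=> [j|].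
  rewrite /valuation_ring /=; case: eqP => _; last exact: (vball0 Hv 0).
  by rewrite (valuation1 Hv).
rewrite (bigD1 i)//= eqxx scale1r big1 ?addr0// => j /negbTE ->.
by rewrite scale0r.
Qed.

Lemma span_scale a x : valuation_ring v a -> L x -> L (a *: x).
Proof.
move=> aO [c [cO ->]]; exists (fun i => a * c i); split=> [i|].
  exact: (@vballM _ _ Hv 0 0 _ _ aO (cO i)).
by rewrite scaler_sumr; apply: eq_bigr => i _; rewrite scalerA.
Qed.

Lemma span_add x y : L x -> L y -> L (x + y).
Proof.
move=> [c [cO ->]] [e [eO ->]]; exists (fun i => c i + e i); split=> [i|].
  exact: (vballD Hv (cO i) (eO i)).
by rewrite -big_split; apply: eq_bigr => i _; rewrite scalerDl.
Qed.

Lemma span_subgroup : is_subgroup L.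
Proof.
split=> [|x y Lx Ly].
  exists (fun=> 0); split=> [i|]; first exact: (vball0 Hv 0).
  by rewrite big1// => i _; rewrite scale0r.
apply: span_add => //; rewrite -scaleN1r; apply: span_scale => //.
by rewrite /valuation_ring /= valuationN1.
Qed.

(** Coefficients in the valuation ring cannot take a combination out of a ball that contains all the
    data. *)
Lemma span_sub_rball : exists n, L `<=` rball v n.
Proof.
have [n nX] := vball_uniform Hv (fun p : 'I_N * 'I_d => tnth X p.1 0 p.2).
exists n => _ [c [cO ->]] j; rewrite summxE; apply: vball_sum => // i.
by rewrite mxE -[n]add0r; exact: (@vballM _ _ Hv 0 n _ _ (cO i) (nX (i, j))).
Qed.

Hypothesis X_full : <<X>>%VS = fullv.

Lemma rball_sub_span : exists n, rball v n `<=` L.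
Proof.
(* [coord X] is linear and rebuilds every vector of the span even when the data are linearly
   dependent. *)
have Xc x : x = \sum_(i < N) coord X i x *: tnth X i.
  rewrite {1}(@coord_span _ _ _ X x) ?X_full ?memvf//.
  by apply: eq_bigr => i _; rewrite (tnth_nth 0).
have [n nX] := vball_uniform Hv (fun p : 'I_N * 'I_d => coord X p.1 (delta_mx 0 p.2)).
(* [n] bounds below the valuations of the coordinates of the standard basis, so entries of valuation
   at least [- n] make all coefficients integral. *)
exists (- n) => x xn; rewrite [x]row_sum_delta.
exists (fun i => \sum_j x 0 j * coord X i (delta_mx 0 j)); split=> [i|].
  apply: (vball_sum Hv (n := 0)) => j; rewrite -[0](addNr n).
  by apply: vballM => //; exact: (nX (i, j)).
rewrite [LHS]Xc; apply: eq_bigr => i _; rewrite linear_sum; congr (_ *: _).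
by apply: eq_bigr => j _; rewrite linearZ.
Qed.

Lemma span_compact : compact L.
Proof.
have [n Ln] := span_sub_rball; have [m mL] := rball_sub_span.
apply: (subclosed_compact _ (rball_compact Hv (n := n)) Ln).
exact: (subgroup_closed (rball_basis Hv d) span_subgroup mL).
Qed.

Lemma span_lattice : is_lattice v L.
Proof.
split; [exact: span_compact|exact: subgroup0 span_subgroup|exact: span_add|exact: span_scale].
Qed.

(** The standard basis, scaled by an element of valuation [n], lies in the ball and stays free. *)
Lemma rball_full_rank n (M : set 'rV[K]_d) : rball v n `<=` M -> full_rank M.
Proof.
move=> nM; have [t t0 tn] := scalar_of_valuation Hv n.
exists [tuple t *: delta_mx 0 i | i < d]; split.
  apply/freeP => k /rowP k0 i; have := k0 i.
  rewrite summxE (bigD1 i)//= big1 => [|j /negbTE ji].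
    by rewrite addr0 (nth_map i) ?size_enum_ord// nth_ord_enum !mxE !eqxx mulr1 => /eqP;
      rewrite mulf_eq0 (negbTE t0) orbF => /eqP.
  by rewrite (nth_map i) ?size_enum_ord// nth_ord_enum !mxE eqxx eq_sym ji !mulr0.
move=> i; rewrite tnth_mktuple; apply: nM => j; rewrite !mxE eqxx /=.
case: eqP => _; rewrite ?mulr1 ?mulr0; first by rewrite /vball /= tn.
exact: vball0.
Qed.

End SpanLattice.

(** * Likelihood of a lattice that contains, or misses, the data *)

Section Likelihood.
Variables (R : realType) (K : localFieldType) (v : K -> \bar int) (d : nat).
Variable lambda_d : {measure set (borelType 'rV[K]_d) -> \bar R}.
Variables (N : nat) (X : N.-tuple 'rV[K]_d) (G : gaussian R v d).
Notation M := (gaussian_lattice G).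

Lemma likelihood_in : (forall i, M (tnth X i)) ->
  likelihood lambda_d X G = (fine (lambda_d M))^-1 ^+ N.
Proof.
move=> XM; rewrite /likelihood (eq_bigr (fun=> (fine (lambda_d M))^-1)).
  by rewrite prodr_const card_ord.
by move=> i _; rewrite /gaussian_density indicE mem_set// mulr1.
Qed.

Lemma likelihood_out i : ~ M (tnth X i) -> likelihood lambda_d X G = 0.
Proof.
move=> XM; rewrite /likelihood (bigD1 i)//= /gaussian_density indicE memNset//.
by rewrite mulr0 mul0r.
Qed.

End Likelihood.

Theorem theorem1p1 (R : realType) (K : localFieldType) (v : K -> \bar int)
    (Hv : normalized_valuation v)
    (lambda : {measure set (borelType K) -> \bar R})
    (Hlambda : normalized_haar v lambda)
    (d : nat) (d_gt0 : (0 < d)%N)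
    (lambda_d : {measure set (borelType 'rV[K]_d) -> \bar R})
    (Hlambda_d : product_measure_of lambda lambda_d)
    (N : nat) (X : N.-tuple 'rV[K]_d) (X_full : <<X>>%VS = fullv) :
  exists G : gaussian R v d,
    [/\ maximizes_likelihood lambda_d X G,
        gaussian_lattice G = span_valuation_ring v X
      & forall G' : gaussian R v d,
          maximizes_likelihood lambda_d X G' -> gaussian_eq G' G].
Proof.
(* Without data every likelihood is the empty product; a positive [N] lets [N]-th roots be taken in
   the uniqueness argument. *)
have N_gt0 : (0 < N)%N.
  have := dim_span X; rewrite X_full dimvf /dim /= mul1n size_tuple.
  exact: leq_trans.
set L := span_valuation_ring v X.
have LL : is_subgroup L := span_subgroup Hv X.
have cL : compact L := span_compact Hv X_full.
have [m mL] : exists m, rball v m `<=` L := rball_sub_span Hv X_full.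
have haar_pos := product_haar_subgroup Hv Hlambda Hlambda_d.
have lL := haar_pos _ _ LL cL mL.
have [P PL] := haar_probability_exists (rball_basis Hv d) LL mL lL
  (product_haar_invariant Hv Hlambda Hlambda_d).
pose G := Gaussian (span_lattice Hv X_full) PL.
have likeG : likelihood lambda_d X G = (fine (lambda_d L))^-1 ^+ N.
  by apply: likelihood_in => i; exact: span_gen.
have fine_pos (M : set 'rV[K]_d) : (0 < lambda_d M < +oo)%E -> 0 < fine (lambda_d M).
  exact: fine_gt0.
have G_full : full_dimensional G by exact: (rball_full_rank Hv mL).
(* A lattice containing the data contains [L], hence the ball [rball v m], which makes it open and
   of positive measure. *)
have sub_pos (M : set 'rV[K]_d) : is_lattice v M -> (forall i, M (tnth X i)) ->
    [/\ L `<=` M, (0 < lambda_d M < +oo)%E & fine (lambda_d L) <= fine (lambda_d M)].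
  move=> lM XM; have LM := span_min lM XM.
  have MM := lattice_subgroup Hv lM; have mM := subset_trans mL LM.
  have lam := haar_pos _ _ MM (lattice_compact lM) mM.
  split=> //; case/andP: lL => l0 loo; case/andP: lam => l0' loo'.
  apply: fine_le; rewrite ?ge0_fin_numE//.
  by apply: le_measure => //; rewrite inE;
    [exact: (measurable_subgroup (rball_basis Hv d) LL mL)
    |exact: (measurable_subgroup (rball_basis Hv d) MM mM)].
exists G; split => //.
  split=> // G' _; rewrite likeG.
  have [XM|/existsNP[i nXM]] := pselect (forall i, gaussian_lattice G' (tnth X i)).
    have [LM lM leLM] := sub_pos _ (gaussian_latticeP G') XM.
    rewrite likelihood_in//; apply: lerXn2r; rewrite ?nnegrE ?invr_ge0 ?fine_ge0//.
    by rewrite lef_pV2 ?posrE ?fine_pos.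
  by rewrite (likelihood_out _ nXM) exprn_ge0// invr_ge0 fine_ge0.
move=> G' [_ /(_ _ G_full)]; rewrite likeG => leG.
(* Missing a datum would give likelihood zero, below the positive likelihood of [G]. *)
have XM i : gaussian_lattice G' (tnth X i).
  apply: contrapT => nXM; move: leG; rewrite (likelihood_out _ nXM) leNgt.
  by rewrite exprn_gt0// invr_gt0 fine_pos.
have [LM lM leLM] := sub_pos _ (gaussian_latticeP G') XM.
have eqM : gaussian_lattice G' = L.
  have MM := lattice_subgroup Hv (gaussian_latticeP G').
  apply: (product_haar_strict Hv Hlambda Hlambda_d LL MM cL mL LM).
  (* Removing the power and the inverse leaves [lambda_d M <= lambda_d L], the converse of
     [leLM]. *)
  move: leG; rewrite likelihood_in// ler_pXn2r ?nnegrE ?invr_ge0 ?fine_ge0//.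
  rewrite lef_pV2 ?posrE ?fine_pos// => geLM.
  case/andP: lL => l0 loo; case/andP: lM => l0' loo'.
  rewrite -[LHS]fineK ?ge0_fin_numE ?ltW// -[RHS]fineK ?ge0_fin_numE ?ltW//.
  by congr _%:E; apply/le_anti/andP.
split=> //; have [P'L P'inv] := gaussian_lawP G'; have [PL1 Pinv] := PL.
rewrite eqM in P'L P'inv.
exact: (haar_probability_unique (rball_basis Hv d) (rball_compact Hv (d := d)) LL cL mL).
Qed.
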